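(* Consider the push-sum algorithm $x(t+1)=W(t)x(t)$, $y(t+1)=W(t)y(t)$, $t\ge 0$, with $x(0)\in\mathbb{R}^n$, $y(0)=\mathbf{1}_n$, $n\ge 2$, where $\{W(t)\}$ is the sequence of random column-stochastic matrices generated by independent Bernoulli links with probability matrices $\{P(t)\}$, and where $\{P(t)\}$ is $B$-irreducible with unit diagonal and with nonzero entries bounded below by $\epsilon>0$ (see context). Let $p=\epsilon^{2(n-1)}$. Then, for any $t\ge B+\frac{2nB}{p}$ and every $i\in[n]$, $$\mathbb{E}\left[\ln\left(\left|z_i(t+1)-\bar{x}\right|\right)\right]\le c_0-c_1t,$$ where $$c_0=\ln\left(2\|x(0)\|_1\right)+\ln(n)\left(\frac{nB}{p}+B\right)+\ln(15),\qquad c_1=-\frac{p}{2nB}\ln\left(1-\frac{1}{n^{4nB/p}}\right).$$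
   Context: $[n]=\{1,\dots,n\}$; time indices $t$ range over non-negative integers; $\mathbf{1}_n$ is the all-ones vector in $\mathbb{R}^n$; $\|\cdot\|_1$ is the $1$-norm. The convention $\ln 0=-\infty$ is used. Push-sum: $x(0)$ is the (deterministic) vector of initial states, $\bar{x}=\frac1n\sum_{i=1}^n x_i(0)$, and $z_i(t+1)=x_i(t+1)/y_i(t+1)$. Random matrices: $W_{ij}(t)=\dfrac{R_{ij}(t)}{\sum_{k=1}^n R_{kj}(t)}$ for $i,j\in[n]$, where $\{R_{ij}(t): i,j\in[n],\,t\ge0\}$ are independent random variables, $R_{ij}(t)=1$ with probability $P_{ij}(t)$ and $R_{ij}(t)=0$ with probability $1-P_{ij}(t)$. Assumption on $\{P(t)\}_{t\ge0}$: it is a (deterministic) sequence of $n\times n$ matrices with $P_{ij}(t)\in[0,1]$; $P_{ii}(t)=1$ for all $i\in[n]$ and $t\ge0$; there is a constant $\epsilon>0$ such that $P_{ij}(t)\ge\epsilon$ for all $i,j\in[n]$ and $t\ge0$ with $P_{ij}(t)\ne0$; and $\{P(t)\}$ is $B$-irreducible for some integer $B>0$, i.e. $\sum_{t'=tB}^{(t+1)B-1}P(t')$ is irreducible for all $t\ge0$. A non-negative matrix $A$ is irreducible if the directed graph on $[n]$ with an edge from $i$ to $j$ iff $A_{ji}>0$ is strongly connected. *)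

(* Defs.v *)
From HB Require Import structures.
From mathcomp Require Import all_boot all_order all_algebra finmap.
From mathcomp Require Import all_classical all_reals all_analysis.

Set Implicit Arguments.
Unset Strict Implicit.
Unset Printing Implicit Defensive.

Import Order.TTheory GRing.Theory Num.Theory.
Import numFieldNormedType.Exports.

Local Open Scope classical_set_scope.
Local Open Scope ring_scope.

Section independence.
Context {d d' : measure_display} {T : measurableType d}
  {T' : measurableType d'} {R : realType}.

Definition mutually_independent (Pr : probability T R) (I : choiceType)
    (X : I -> {RV Pr >-> T'}) : Prop :=
  forall (F : {fset I}) (A : I -> set T'), (forall k, measurable (A k)) ->
    Pr (\bigcap_(k in [set` F]) (X k @^-1` A k)) =
    (\prod_(k <- F) Pr (X k @^-1` A k))%E.

End independence.

Section bernoulli_rv.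
Context {d : measure_display} {T : measurableType d} {R : realType}.

(* Values other than 0 and 1 are only excluded almost surely. *)
Definition bernoulli_rv (Pr : probability T R) (X : {RV Pr >-> R}) (q : R)
    : Prop :=
  Pr (X @^-1` [set 1]) = q%:E /\ Pr (X @^-1` [set 0]) = (1 - q)%:E.

End bernoulli_rv.

Section matrices.
Context {R : realType} {n : nat}.

(* The graph of A has an edge from i to j iff the entry in row j and column i
   is positive. *)
Definition irreducible_mx (A : 'M[R]_n) : Prop :=
  forall i j : 'I_n, connect [rel u v : 'I_n | 0 < A v u] i j.

Definition B_irreducible (B : nat) (P : nat -> 'M[R]_n) : Prop :=
  forall t : nat, irreducible_mx (\sum_(t * B <= s < t.+1 * B) P s).

Definition column_normalize (A : 'M[R]_n) : 'M[R]_n :=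
  \matrix_(i, j) (A i j / \sum_k A k j).

Fixpoint linear_iter (W : nat -> 'M[R]_n) (v0 : 'cV[R]_n) (t : nat)
    : 'cV[R]_n :=
  if t is s.+1 then W s *m linear_iter W v0 s else v0.

Definition push_sum_ratio (W : nat -> 'M[R]_n) (x0 : 'cV[R]_n) (t : nat)
    (i : 'I_n) : R :=
  linear_iter W x0 t i 0 / linear_iter W (const_mx 1) t i 0.

Definition average (v : 'cV[R]_n) : R := n%:R^-1 * \sum_i v i 0.

Definition norm1 (v : 'cV[R]_n) : R := \sum_i `|v i 0|.

End matrices.

Section link_matrices.
Context {d : measure_display} {T : measurableType d} {R : realType} {n : nat}.

Definition random_weights (Pr : probability T R)
    (L : nat -> 'I_n -> 'I_n -> {RV Pr >-> R}) (w : T) (t : nat) : 'M[R]_n :=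
  column_normalize (\matrix_(i, j) L t i j w).

End link_matrices.

(* Main.v *)
Require Import Defs.
From HB Require Import structures.
From mathcomp Require Import all_boot all_order all_algebra finmap.
From mathcomp Require Import all_classical all_reals all_analysis.
From mathcomp Require Import measurable_realfun.
From mathcomp Require Import ring lra zify.

Set Implicit Arguments.
Unset Strict Implicit.
Unset Printing Implicit Defensive.

Import Order.TTheory GRing.Theory Num.Theory.
Import numFieldNormedType.Exports.

Local Open Scope classical_set_scope.
Local Open Scope ring_scope.

(** Let v(t) = x(t) - xbar y(t).  It evolves by the same matrices as x and y,
    its entries sum to 0, and z_i - xbar = v_i / y_i.  Hence
    ln |z_i(t+1) - xbar| <= ln |v(t+1)|_1 - ln y_i(t+1), and since logarithms
    turn the two factors into two summands, each can be bounded in expectation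
    without any independence between them.

    Cut time into windows of B steps.  By irreducibility each window contains
    a family of at most 2(n-1) links of nonzero probability whose arcs strongly
    connect the nodes, namely an out-tree and an in-tree with a common root
    ([strongly_connected_links]).  Call the window good when all these links
    are active: this has probability at least p = eps^(2(n-1)), and different
    windows are independent since they involve disjoint families of independent
    links.  Active links have weight at least 1/n, and every node keeps at least
    1/n of its own value.
    Going back in time from a node i, the set of nodes that send to i at least
    n^-(elapsed time) of their value never shrinks, and gains a node at each
    good window until it is everything ([reach_grow]).  So the product of the
    weights over a stretch of l steps containing n-1 good windows has all its
    entries at least n^-l ([flow_lower_bound]).

    This is used twice.  Backwards from t+1: the total mass of y is n, so
    y_i(t+1) >= n^-(time needed to meet n-1 good windows)
    ([mass_lower_bound]), and the expected number of windows needed is at most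
    (n-1)/p ([expected_waiting_time]).  Forwards from 0, in blocks of q windows
    with q about 2(n-1)/p: a block containing n-1 good windows contracts the
    1-norm of v by 1 - n^-(qB) ([norm1_blocks]), and by the same waiting-time
    bound and Markov's inequality it does so with probability at least 1/2.

    Together, with K complete blocks ([expected_log_error_le]),
    E ln |z_i(t+1) - xbar| <= ln (2|x(0)|_1) + ln n (B + B(n-1)/p)
                              + (K/2) ln (1 - n^-(qB)).
    Put a = n^(-2nB/p) and s = tp/(2nB).  Then qB <= 2nB/p and K >= s - 2, and
    a <= 1/2 gives (1/2) ln (1-a) <= ln (1-a^2), which is the announced rate;
    the two missing blocks cost - ln (1-a) <= ln 15 ([half_block_rate]).  For
    x(0) = 0 both sides are -oo. *)

(** * Spanning sets of links *)

Lemma crossing_edge (V : finType) (e : rel V) (A : {set V}) (x y : V) :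
  x \in A -> y \notin A -> connect e x y ->
  exists u v, [/\ u \in A, v \notin A & e u v].
Proof.
move=> xA yA /connectP[q]; elim: q x xA => [|z q IH] x xA /=.
  by move=> _ yx; rewrite yx xA in yA.
case/andP=> exz pz ylast; have [zA|zA] := boolP (z \in A).
  exact: IH zA pz ylast.
by exists x, z.
Qed.

Lemma exists_notin (V : finType) (A : {set V}) :
  A != [set: V]%SET -> exists y, y \notin A.
Proof.
move=> AT; apply/existsP; apply: contraR AT; rewrite negb_exists => /forallP AT.
by apply/eqP/setP => y; rewrite inE; have /negPn := AT y.
Qed.

Definition link_rel (V : finType) (E : eqType) (src tgt : E -> V)
    (F : seq E) : rel V :=
  fun u v => has (fun l => (src l == u) && (tgt l == v)) F.

Lemma connect_link_rel_sub (V : finType) (E : eqType) (src tgt : E -> V)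
    (F1 F2 : seq E) (u v : V) : {subset F1 <= F2} ->
  connect (link_rel src tgt F1) u v -> connect (link_rel src tgt F2) u v.
Proof.
move=> F12; apply: connect_sub => x y /hasP[l lF1 lxy]; apply: connect1.
by apply/hasP; exists l => //; exact: F12.
Qed.

(** The tree is grown from [r] one link at a time: as long as it misses a node,
    the hypothesis supplies a link that leaves it.  Links carry data besides
    their end points, so they are drawn from an arbitrary type [E] of labelled
    arcs constrained by [Q]. *)
Lemma spanning_tree (V : finType) (E : eqType) (src tgt : E -> V)
    (Q : E -> Prop) (r : V) :
  (forall A : {set V}, r \in A -> A != [set: V]%SET ->
     exists l, [/\ Q l, src l \in A & tgt l \notin A]) ->
  exists F : seq E, [/\ (size F <= #|V|.-1)%N,
    forall l, l \in F -> Q l & forall v, connect (link_rel src tgt F) r v].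
Proof.
move=> cross.
suff grow k : (k < #|V|)%N -> exists (A : {set V}) (F : seq E),
    [/\ #|A| = k.+1, (size F <= k)%N, forall l, l \in F -> Q l, r \in A &
        forall v, v \in A -> connect (link_rel src tgt F) r v].
  have V0 : (0 < #|V|)%N by apply/card_gt0P; exists r.
  have [|A [F [cA sF QF _ FA]]] := grow #|V|.-1; first by rewrite prednK.
  exists F; split=> // v; apply: FA.
  suff -> : A = [set: V]%SET by rewrite inE.
  by apply/eqP; rewrite eqEcard finset.subsetT cardsT cA prednK /=.
elim: k => [_|k IH kV].
  exists [set r]%SET, [::]; split => //; rewrite ?cards1 ?inE//.
  by move=> v; rewrite inE => /eqP ->; exact: connect0.
have [A [F [cA sF QF rA FA]]] := IH (ltnW kV).
have [|l [Ql lA lnA]] := cross A rA.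
  by apply: contraTneq kV => AT; rewrite -cA AT cardsT ltnn.
exists (tgt l |: A)%SET, (l :: F); split.
- by rewrite cardsU1 lnA cA.
- by rewrite /= ltnS.
- by move=> l'; rewrite inE => /predU1P[->//|]; exact: QF.
- by rewrite !inE rA orbT.
- have FlF v : connect (link_rel src tgt F) r v ->
      connect (link_rel src tgt (l :: F)) r v.
    by apply: connect_link_rel_sub => l' l'F; rewrite inE l'F orbT.
  move=> v; rewrite !inE => /predU1P[->|/FA /FlF //].
  apply: (connect_trans (FlF _ (FA _ lA))); apply: connect1.
  by rewrite /link_rel /= !eqxx.
Qed.

(** Any node can go to any other through a fixed root [r], so an out-tree and an
    in-tree at [r] suffice, with [#|V|.-1] links each. *)
Lemma strongly_connected_links (V : finType) (E : eqType) (src tgt : E -> V)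
    (Q : E -> Prop) (e : rel V) :
  (forall u v, e u v -> exists l, [/\ Q l, src l = u & tgt l = v]) ->
  (forall u v, connect e u v) ->
  exists F : seq E, [/\ (size F <= 2 * #|V|.-1)%N,
    forall l, l \in F -> Q l & forall u v, connect (link_rel src tgt F) u v].
Proof.
move=> eQ econn; have [V0|V0] := eqVneq #|V| 0%N.
  by exists [::]; split=> // u; have := fintype0 u V0.
have /card_gt0P[r _] : (0 < #|V|)%N by rewrite lt0n.
have [A rA AT|F1 [sF1 QF1 cF1]] := @spanning_tree V E src tgt Q r.
  have [y yA] := exists_notin AT.
  have [u [v [uA vA euv]]] := crossing_edge rA yA (econn r y).
  by have [l [Ql lu lv]] := eQ _ _ euv; exists l; rewrite lu lv.
(* The in-tree is an out-tree of the reversed graph. *)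
have [A rA AT|F2 [sF2 QF2 cF2]] := @spanning_tree V E tgt src Q r.
  have [y yA] := exists_notin AT.
  have [||u [v [uA vA euv]]] := @crossing_edge V e (~: A)%SET y r _ _ (econn y r).
  - by rewrite inE.
  - by rewrite inE negbK.
  have [l [Ql lu lv]] := eQ _ _ euv; exists l; rewrite lu lv; split=> //.
  - by rewrite inE negbK in vA.
  - by rewrite inE in uA.
exists (F1 ++ F2); split.
- by rewrite size_cat mul2n -addnn leq_add.
- by move=> l; rewrite mem_cat => /orP[/QF1|/QF2].
move=> u v; apply: (@connect_trans _ _ r).
  have : connect (link_rel src tgt F2) u r.
    have -> : connect (link_rel src tgt F2) u r
              = connect [rel x y | link_rel tgt src F2 y x] u r.
      by apply: eq_connect => x y; apply: eq_has => l; rewrite andbC.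
    by rewrite connect_rev /=.
  by apply: connect_link_rel_sub => l lF; rewrite mem_cat lF orbT.
by apply: connect_link_rel_sub (cF1 v) => l lF; rewrite mem_cat lF.
Qed.

(** * Products of column-stochastic matrices *)

Section weights.
Context {R : realType} {n : nat}.
Implicit Types (W : nat -> 'M[R]_n) (A : 'M[R]_n) (v : 'cV[R]_n).

Definition column_stochastic A : Prop :=
  (forall i j, 0 <= A i j) /\ (forall j, \sum_i A i j = 1).

Definition lazy_weights A : Prop :=
  column_stochastic A /\ forall i, n%:R^-1 <= A i i.

(** The product [W (s + k - 1) *m ... *m W s]; unfolding on the earliest factor
    suits arguments that go back in time. *)
Fixpoint flow W (s k : nat) : 'M[R]_n :=
  if k is k'.+1 then flow W s.+1 k' *m W s else 1%:M.

Lemma linear_iter_flow W v s k :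
  linear_iter W v (s + k) = flow W s k *m linear_iter W v s.
Proof.
elim: k s => [s|k IH s]; first by rewrite addn0 mul1mx.
by rewrite addnS -addSn IH /= mulmxA.
Qed.

Lemma linear_iterB W v1 v2 t :
  linear_iter W (v1 - v2) t = linear_iter W v1 t - linear_iter W v2 t.
Proof. by elim: t => [//|t IH] /=; rewrite IH mulmxBr. Qed.

Lemma linear_iterZ W a v t :
  linear_iter W (a *: v) t = a *: linear_iter W v t.
Proof. by elim: t => [//|t IH] /=; rewrite IH scalemxAr. Qed.

Lemma column_stochastic1 : column_stochastic 1%:M.
Proof.
split=> [i j|j]; first by rewrite !mxE; case: eqP.
rewrite (bigD1 j)//= big1 ?addr0 ?mxE ?eqxx// => i /negbTE ij.
by rewrite !mxE ij.
Qed.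

Lemma sum_mulmx_col A v : (forall j, \sum_i A i j = 1) ->
  \sum_i (A *m v) i 0 = \sum_j v j 0.
Proof.
move=> A1; under eq_bigr do rewrite mxE.
rewrite exchange_big /=; apply: eq_bigr => j _.
by rewrite -mulr_suml A1 mul1r.
Qed.

Lemma column_stochasticM A1 A2 :
  column_stochastic A1 -> column_stochastic A2 -> column_stochastic (A1 *m A2).
Proof.
move=> [A1ge0 A1sum] [A2ge0 A2sum]; split=> [i j|j].
  by rewrite mxE sumr_ge0// => k _; rewrite mulr_ge0.
have -> : \sum_i (A1 *m A2) i j = \sum_i (A1 *m col j A2) i 0.
  by apply: eq_bigr => i _; rewrite !mxE; apply: eq_bigr => k _; rewrite mxE.
by rewrite sum_mulmx_col// -(A2sum j); apply: eq_bigr => i _; rewrite mxE.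
Qed.

(** Subtracting [alpha] from every entry of [A] does not change its action on a
    vector of sum 0, and lowers the column sums to [1 - n alpha]. *)
Lemma norm1_mulmx A v alpha : column_stochastic A ->
  (forall i j, alpha <= A i j) -> \sum_i v i 0 = 0 ->
  norm1 (A *m v) <= (1 - n%:R * alpha) * norm1 v.
Proof.
move=> [_ A1] Aalpha v0; rewrite /norm1.
have AvE i : (A *m v) i 0 = \sum_j (A i j - alpha) * v j 0.
  rewrite mxE; under [RHS]eq_bigr do rewrite mulrBl.
  by rewrite sumrB -mulr_sumr v0 mulr0 subr0.
apply: (@le_trans _ _ (\sum_i \sum_j (A i j - alpha) * `|v j 0|)).
  apply: ler_sum => i _; rewrite AvE (le_trans (ler_norm_sum _ _ _))//.
  by apply: ler_sum => j _; rewrite normrM ger0_norm// subr_ge0.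
rewrite exchange_big mulr_sumr /=; apply: ler_sum => j _.
by rewrite -mulr_suml sumrB A1 sumr_const card_ord mulr_natl.
Qed.

Lemma norm1_mulmx_le A v : column_stochastic A -> \sum_i v i 0 = 0 ->
  norm1 (A *m v) <= norm1 v.
Proof.
move=> As v0; rewrite -[leRHS]mul1r.
by rewrite (le_trans (norm1_mulmx (alpha := 0) As As.1 v0))// mulr0 subr0.
Qed.

Lemma norm_le_norm1 v i : `|v i 0| <= norm1 v.
Proof. by rewrite /norm1 (bigD1 i)//= lerDl sumr_ge0. Qed.

Lemma norm1_ge0 v : 0 <= norm1 v.
Proof. exact: sumr_ge0. Qed.

Lemma norm1_eq0 v : norm1 v = 0 -> v = 0.
Proof.
move=> v0; apply/colP => i; apply/eqP; rewrite mxE -normr_le0 -v0.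
exact: norm_le_norm1.
Qed.

Section positivity.
Variables (W : nat -> 'M[R]_n).
Hypothesis lazyW : forall s, lazy_weights (W s).

Lemma flow_stochastic s k : column_stochastic (flow W s k).
Proof.
elim: k s => [s|k IH s] /=; first exact: column_stochastic1.
by apply: column_stochasticM => //; exact: (lazyW s).1.
Qed.

Lemma sum_linear_iter v t : \sum_i linear_iter W v t i 0 = \sum_i v i 0.
Proof.
elim: t => [//|t IH] /=; rewrite sum_mulmx_col//; exact: (lazyW t).1.2.
Qed.

Lemma linear_iter_ge0 v t : (forall i, 0 <= v i 0) ->
  forall i, 0 <= linear_iter W v t i 0.
Proof.
move=> v0; elim: t => [//|t IH] i /=; rewrite mxE sumr_ge0// => j _.
by rewrite mulr_ge0//; exact: (lazyW t).1.1.
Qed.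

(** The nodes whose value at time [s] contributes to node [i] at time [T] with a
    factor [1/n] per step, the least weight of an active link. *)
Definition reach (T : nat) (i : 'I_n) (s : nat) : {set 'I_n} :=
  [set j | n%:R^-1 ^+ (T - s) <= flow W s (T - s) i j]%SET.

Lemma reach_step T i s j j' : (s < T)%N -> j \in reach T i s.+1 ->
  n%:R^-1 <= W s j j' -> j' \in reach T i s.
Proof.
move=> sT; rewrite !inE => jr wj.
have -> : (T - s = (T - s.+1).+1)%N by rewrite subnSK.
rewrite /= mxE (bigD1 j)//= exprSr.
rewrite -[leLHS]addr0 lerD//.
  by rewrite ler_pM// ?exprn_ge0// invr_ge0.
rewrite sumr_ge0// => k _; rewrite mulr_ge0//.
  exact: (flow_stochastic _ _).1.
exact: (lazyW s).1.1.
Qed.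

Lemma reach_mono T i s s' : (s <= s' <= T)%N -> reach T i s' \subset reach T i s.
Proof.
case/andP=> /subnK <-; elim: (s' - s)%N => [//|k IH] kT.
apply: fintype.subset_trans (IH _); last by lia.
apply/fintype.subsetP => j jr; rewrite addSn in jr kT.
by apply: (reach_step kT jr); exact: (lazyW _).2.
Qed.

Lemma reach_self T i s : (s <= T)%N -> i \in reach T i s.
Proof.
move=> sT; have := @reach_mono T i s T; rewrite sT leqnn => /(_ isT).
by move/fintype.subsetP; apply; rewrite inE subnn /= mxE eqxx expr0.
Qed.

Definition connected_over (s1 s2 : nat) : Prop :=
  exists F : seq (nat * 'I_n * 'I_n),
    (forall l, l \in F ->
       (s1 <= l.1.1 < s2)%N /\ n%:R^-1 <= W l.1.1 l.1.2 l.2) /\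
    (forall i j, connect (link_rel (fun l => l.2) (fun l => l.1.2) F) i j).

(** Going back over a strongly connected stretch, the reached set grows unless
    it is already everything: a path from a missing node to [i] has an arc [u -> v]
    that enters the set.  This arc is active at some time inside the stretch,
    when [v] is still reached, and from then on [u] is reached too. *)
Lemma reach_grow T i s1 s2 : (s1 <= s2 <= T)%N -> connected_over s1 s2 ->
  (minn n #|reach T i s2|.+1 <= #|reach T i s1|)%N.
Proof.
move=> /andP[s12 s2T] [F [Fw Fc]].
have sub12 : reach T i s2 \subset reach T i s1 by rewrite reach_mono// s12.
have [full|/forallPn[j jr]] := boolP [forall j, j \in reach T i s2].
  have -> : reach T i s1 = [set: 'I_n]%SET.
    by apply/setP => j; rewrite [RHS]inE (fintype.subsetP sub12)// (forallP full).
  by rewrite cardsT card_ord geq_minl.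
rewrite geq_min; apply/orP; right; apply: proper_card.
have [||u [v [ur vr /hasP[l lF /andP[/eqP lu /eqP lv]]]]] :=
  @crossing_edge _ _ (~: reach T i s2)%SET j i _ _ (Fc j i).
- by rewrite inE.
- by rewrite inE negbK reach_self.
rewrite !inE /= in ur; rewrite inE negbK in vr.
have [/andP[ls1 ls2] lw] := Fw _ lF.
apply/properP; split=> //; exists u; last by rewrite inE.
have ul : u \in reach T i l.1.1.
  have lT : (l.1.1 < T)%N := leq_trans ls2 s2T.
  apply: (@reach_step _ _ _ v) => //; last by rewrite -lu -lv.
  have /fintype.subsetP r12 : reach T i s2 \subset reach T i l.1.1.+1.
    by apply: reach_mono; rewrite ls2.
  exact: r12.
have /fintype.subsetP l1 : reach T i l.1.1 \subset reach T i s1.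
  by apply: reach_mono; rewrite ls1 (leq_trans (ltnW ls2)).
exact: l1.
Qed.

Variables (B : nat) (good : pred nat).
Hypothesis goodP : forall k, good k -> connected_over (k * B) (k.+1 * B).

Lemma reach_count T i a k : ((a + k) * B <= T)%N ->
  (minn n (count good (iota a k)).+1 <= #|reach T i (a * B)|)%N.
Proof.
elim: k a => [|k IH] a aT /=.
  rewrite addn0 in aT; apply: leq_trans (geq_minr _ _) _.
  by apply/card_gt0P; exists i; exact: reach_self.
have aT' : ((a.+1 + k) * B <= T)%N by rewrite addSnnS.
have saT : (a * B <= a.+1 * B <= T)%N.
  by rewrite leq_mul2r leqnSn orbT /= (leq_trans _ aT')// leq_mul2r leq_addr orbT.
have [/goodP ga|_] := boolP (good a); last first.
  rewrite add0n (leq_trans (IH _ aT'))// subset_leq_card//; exact: reach_mono.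
move: (reach_grow i saT ga) (IH _ aT') => /=.
move: #|_| #|_| (count _ _) => x1 x2 c; lia.
Qed.

Lemma flow_lower_bound T a k i j : ((a + k) * B <= T)%N ->
  (n.-1 <= count good (iota a k))%N ->
  n%:R^-1 ^+ (T - a * B) <= flow W (a * B) (T - a * B) i j.
Proof.
move=> akT cnt; have := reach_count i akT.
have -> : minn n (count good (iota a k)).+1 = n by lia.
rewrite -{1}[n]card_ord -cardsT => full.
have : j \in [set: 'I_n]%SET by rewrite inE.
have /eqP <- : reach T i (a * B) == [set: 'I_n]%SET.
  by rewrite eqEcard finset.subsetT.
by rewrite inE.
Qed.

(** The number of windows to go back from window [m] until [n.-1] good ones have
    been met, capped at [m]: it is written as a sum of indicators because these
    are the form in which its expectation is computed. *)
Definition waiting_time (m : nat) : nat :=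
  \sum_(0 <= k < m) (count good (iota (m - k) k) < n.-1)%N.

(** If some number [k] of windows before time [m * B] contains [n.-1] good ones,
    then [i] receives at least [n^-1] per step from all the mass, which is [n],
    present [k] windows earlier, and the least such [k] is at most the waiting
    time.  Otherwise the waiting time is [m], and the mass that [i] keeps for
    itself from time 0 on suffices. *)
Lemma mass_lower_bound m r i : (0 < n)%N ->
  n%:R^-1 ^+ (r + B * waiting_time m)
    <= linear_iter W (const_mx 1) (m * B + r) i 0.
Proof.
move=> n0; set T := (m * B + r)%N; set y := linear_iter _ _.
have n1 : n%:R^-1 <= 1 :> R by rewrite invf_le1 ?ltr0n// ler1n.
have n'0 : 0 <= n%:R^-1 :> R by rewrite invr_ge0.
have y0 t j : 0 <= y t j 0.
  by apply: linear_iter_ge0 => k; rewrite mxE.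
have wait k : (k <= m)%N ->
    (forall k', (k' < k)%N -> count good (iota (m - k') k') < n.-1)%N ->
    (k <= waiting_time m)%N.
  move=> km small; rewrite /waiting_time (big_cat_nat (n := k))//=.
  rewrite (leq_trans _ (leq_addr _ _))// big_nat.
  under eq_bigr => k' k'k do rewrite small//.
  by rewrite -big_nat sum_nat_const_nat subn0 muln1.
have [[k [km [cntk small]]]|none] := pselect (exists k, (k <= m)%N /\
    (n.-1 <= count good (iota (m - k) k))%N /\
    forall k', (k' < k)%N -> (count good (iota (m - k') k') < n.-1)%N).
  have kw := wait _ km small.
  have mkB : ((m - k + k) * B <= T)%N by rewrite subnK// leq_addr.
  have mkT : ((m - k) * B <= T)%N.
    by rewrite (leq_trans _ mkB)// leq_mul2r leq_addr orbT.
  rewrite -(subnKC mkT) /y linear_iter_flow mxE.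
  apply: (@le_trans _ _ (\sum_j n%:R^-1 ^+ (T - (m - k) * B) * y ((m - k) * B)%N j 0)).
    rewrite -mulr_sumr sum_linear_iter.
    have -> : \sum_i (const_mx 1 : 'cV[R]_n) i 0 = n%:R.
      by under eq_bigr do rewrite mxE; rewrite sumr_const card_ord.
    rewrite -[leLHS]mulr1 ler_pM ?exprn_ge0// ?ler1n//.
    apply: ler_wiXn2l => //.
    have : (k * B <= waiting_time m * B)%N by rewrite leq_mul2r kw orbT.
    by rewrite /T mulnBl [(B * _)%N]mulnC; lia.
  apply: ler_sum => j _; rewrite ler_wpM2r ?y0//.
  exact: flow_lower_bound cntk.
have kw : (m <= waiting_time m)%N.
  apply: wait => // k km; elim/ltn_ind: k km => k IH km.
  rewrite ltnNge; apply/negP => cntk; apply: none; exists k; split; first exact: ltnW.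
  split=> // k' k'k; apply: IH => //; exact: ltn_trans km.
have := reach_self (T := T) i (leq0n _); rewrite inE subn0 => i0.
rewrite -[T in y T]add0n /y linear_iter_flow mxE (bigD1 i)//= mxE mulr1.
rewrite -[leLHS]addr0 lerD//.
  apply: le_trans i0; apply: ler_wiXn2l => //.
  by rewrite /T mulnC addnC leq_add2l leq_mul2l kw orbT.
by apply: sumr_ge0 => j _; rewrite mxE mulr1; exact: (flow_stochastic _ _).1.
Qed.

Lemma norm1_linear_iter_le v s k : \sum_i v i 0 = 0 ->
  norm1 (linear_iter W v (s + k)) <= norm1 (linear_iter W v s).
Proof.
move=> v0; rewrite linear_iter_flow norm1_mulmx_le ?sum_linear_iter//.
exact: flow_stochastic.
Qed.

Definition block_factor (q b : nat) : R :=
  if (n.-1 <= count good (iota (b * q) q))%N then 1 - n%:R^-1 ^+ (q * B) else 1.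

(** The contraction factor of a good block is in fact [1 - n * n^-(q * B)]; the
    factor [n] is given up. *)
Lemma norm1_blocks v q K : (0 < n)%N -> \sum_i v i 0 = 0 ->
  norm1 (linear_iter W v (K * q * B)) <= norm1 v * \prod_(b < K) block_factor q b.
Proof.
move=> n0 v0; elim: K => [|K IH]; first by rewrite big_ord0 mulr1.
rewrite big_ord_recr /= mulrA.
have -> : (K.+1 * q * B = K * q * B + q * B)%N by rewrite mulSn addnC mulnDl.
rewrite /block_factor; case: ifPn => cnt; last first.
  by rewrite mulr1 (le_trans (norm1_linear_iter_le _ _ v0)).
have n1 : n%:R^-1 <= 1 :> R by rewrite invf_le1 ?ltr0n// ler1n.
have n'0 : 0 <= n%:R^-1 :> R by rewrite invr_ge0.
have a1 : n%:R^-1 ^+ (q * B) <= 1 :> R by rewrite exprn_ile1.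
have entries i j : n%:R^-1 ^+ (q * B) <= flow W (K * q * B) (q * B) i j.
  have := @flow_lower_bound ((K * q + q) * B) (K * q) q i j (leqnn _) cnt.
  by rewrite mulnDl addKn.
rewrite linear_iter_flow.
have := norm1_mulmx (flow_stochastic _ _) entries.
move=> /(_ (linear_iter W v (K * q * B))); rewrite sum_linear_iter => /(_ v0).
move=> /le_trans; apply; rewrite mulrC.
apply: (@le_trans _ _ (norm1 (linear_iter W v (K * q * B))
                       * (1 - n%:R^-1 ^+ (q * B)))); last first.
  by rewrite ler_wpM2r// subr_ge0.
by rewrite ler_wpM2l ?norm1_ge0// lerD2l lerN2 ler_peMl ?exprn_ge0// ler1n.
Qed.

(** The deviation from the average is [v i 0 / y i 0], where [v] is the image of
    [x0 - average x0 *: 1], a vector of sum 0 and norm at most [2 * norm1 x0]. *)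
Lemma push_sum_error_bound (x0 : 'cV[R]_n) m r q K i :
  (0 < n)%N -> (K * q <= m)%N ->
  `|push_sum_ratio W x0 (m * B + r) i - average x0|
    <= 2 * norm1 x0 * \prod_(b < K) block_factor q b
       * n%:R ^+ (r + B * waiting_time m).
Proof.
move=> n0 Kqm; set t := (m * B + r)%N.
have nR : (n%:R : R) != 0 by rewrite pnatr_eq0 -lt0n.
have n'0 : 0 < n%:R^-1 :> R by rewrite invr_gt0 ltr0n.
have ylow := mass_lower_bound m r i n0.
set y := linear_iter W (const_mx 1) t i 0 in ylow.
have y0 : 0 < y by apply: lt_le_trans ylow; rewrite exprn_gt0.
pose v : 'cV[R]_n := x0 - average x0 *: const_mx 1.
have v0 : \sum_i v i 0 = 0.
  under eq_bigr do rewrite !mxE mulr1.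
  by rewrite sumrB sumr_const card_ord /average -[X in _ - X]mulr_natl mulrA divff// mul1r subrr.
have -> : push_sum_ratio W x0 t i - average x0 = linear_iter W v t i 0 / y.
  rewrite /push_sum_ratio -/y linear_iterB linear_iterZ !mxE -/y.
  by rewrite mulrBl mulfK// gt_eqF.
rewrite normrM normfV (gtr0_norm y0).
apply: ler_pM => //; first by rewrite invr_ge0 ltW.
- apply: le_trans (norm_le_norm1 _ _) _.
  have -> : t = (K * q * B + (t - K * q * B))%N.
    by rewrite subnKC// /t (leq_trans _ (leq_addr _ _))// leq_mul2r Kqm orbT.
  apply: le_trans (norm1_linear_iter_le _ _ v0) _.
  apply: le_trans (norm1_blocks _ _ n0 v0) _.
  rewrite ler_wpM2r//.
    apply: prodr_ge0 => b _; rewrite /block_factor; case: ifP => // _.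
    by rewrite subr_ge0 exprn_ile1// ?invr_ge0// invf_le1 ?ltr0n// ler1n.
  rewrite /norm1 mulr_natl mulr2n.
  apply: (@le_trans _ _ (\sum_j (`|x0 j 0| + `|average x0|))).
    by apply: ler_sum => j _; rewrite !mxE mulr1 ler_normB.
  rewrite big_split /= lerD2l sumr_const card_ord /average normrM.
  rewrite gtr0_norm// -[_ *+ n]mulr_natl mulrA divff// mul1r.
  exact: ler_norm_sum.
- rewrite -[leRHS]invrK lef_pV2 ?posrE//; first by rewrite -exprVn.
  by rewrite invr_gt0 exprn_gt0// ltr0n.
Qed.

End positivity.
End weights.

(** * Counts of independent events *)

Section event_counts.
Context {d : measure_display} {T : measurableType d} {R : realType}.
Variables (Pr : probability T R) (G : nat -> set T).
Hypothesis mG : forall j, measurable (G j).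

Definition prob (A : set T) : R := fine (Pr A).

Lemma probE A : measurable A -> Pr A = (prob A)%:E.
Proof. by move=> mA; rewrite /prob fineK// fin_num_measure. Qed.

Lemma prob_ge0 A : 0 <= prob A.
Proof. exact: fine_ge0. Qed.

Lemma prob0 : prob set0 = 0.
Proof. by rewrite /prob measure0. Qed.

Lemma probT : prob setT = 1.
Proof. by rewrite /prob probability_setT. Qed.

Lemma prob_le A C : measurable A -> measurable C -> A `<=` C ->
  prob A <= prob C.
Proof.
by move=> mA mC AC; rewrite -lee_fin -!probE// le_measure// inE.
Qed.

Lemma prob_split A C : measurable A -> measurable C ->
  prob A = prob (A `&` C) + prob (A `\` C).
Proof.
move=> mA mC; have mI : measurable (A `&` C) by exact: measurableI.
have mD : measurable (A `\` C) by exact: measurableD.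
by apply: EFin_inj; rewrite EFinD -!probE// addeC; exact: measureDI.
Qed.

Definition all_occur (J : seq nat) : set T :=
  [set w | all (fun j => w \in G j) J].

Definition few_occur (c : nat) (s : seq nat) : set T :=
  [set w | (count (fun j => w \in G j) s < c)%N].

Lemma all_occur_cons j J : all_occur (j :: J) = G j `&` all_occur J.
Proof.
apply/seteqP; split=> w /=; first by move=> /andP[/set_mem].
by move=> [Gw Jw]; apply/andP; split=> //; exact: mem_set.
Qed.

Lemma all_occur_nil : all_occur [::] = setT.
Proof. exact/seteqP. Qed.

Lemma measurable_all_occur J : measurable (all_occur J).
Proof.
elim: J => [|j J IH]; first by rewrite all_occur_nil.
by rewrite all_occur_cons; exact: measurableI.
Qed.

Lemma few_occur0 s : few_occur 0 s = set0.
Proof. by apply/seteqP; split. Qed.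

Lemma few_occur_nil c : few_occur c.+1 [::] = setT.
Proof. by apply/seteqP; split. Qed.

Lemma few_occur_consI c j s :
  few_occur c.+1 (j :: s) `&` G j = few_occur c s `&` G j.
Proof.
by apply/seteqP; split=> w [/= cw Gw]; split=> //; move: cw;
  rewrite /few_occur /= (mem_set Gw).
Qed.

Lemma few_occur_consD c j s :
  few_occur c (j :: s) `\` G j = few_occur c s `\` G j.
Proof.
by apply/seteqP; split=> w [/= cw Gw]; split=> //; move: cw;
  rewrite /few_occur /= (memNset Gw).
Qed.

Lemma measurable_few_occur c s : measurable (few_occur c s).
Proof.
elim: s c => [|j s IH] [|c]; rewrite ?few_occur0 ?few_occur_nil//.
rewrite -(setUIDK (few_occur c.+1 (j :: s)) (G j)) few_occur_consI few_occur_consD.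
by apply: measurableU; [exact: measurableI|exact: measurableD].
Qed.

(** Conditioning on [G j]: when it occurs one success fewer is allowed among the
    rest.  The complement of [G j] is eliminated by inclusion-exclusion, so that
    only intersections of the events [G] remain. *)
Lemma prob_few_occur_cons c j s A : measurable A ->
  prob (few_occur c.+1 (j :: s) `&` A) =
  prob (few_occur c s `&` (G j `&` A)) +
  (prob (few_occur c.+1 s `&` A) - prob (few_occur c.+1 s `&` (G j `&` A))).
Proof.
move=> mA; have mE := measurable_few_occur.
rewrite (prob_split (measurableI _ _ (mE c.+1 (j :: s)) mA) (mG j)).
rewrite (prob_split (measurableI _ _ (mE c.+1 s) mA) (mG j)).
have swap D : D `&` A `&` G j = D `&` G j `&` A by rewrite setIAC.
have swapD D : (D `&` A) `\` G j = (D `\` G j) `&` A by rewrite !setDE setIAC.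
by rewrite !swap !swapD few_occur_consI few_occur_consD !setIA; ring.
Qed.

Hypothesis indepG : forall J : seq nat, uniq J ->
  prob (all_occur J) = \prod_(j <- J) prob (G j).

Lemma few_occur_indep c s J : uniq (s ++ J) ->
  prob (few_occur c s `&` all_occur J) =
  prob (few_occur c s) * prob (all_occur J).
Proof.
elim: s c J => [|j s IH] [|c] J; rewrite ?few_occur0 ?few_occur_nil;
  rewrite ?set0I ?setTI ?prob0 ?probT ?mul0r ?mul1r// => uJ.
have usjJ : uniq (s ++ j :: J).
  rewrite -(perm_uniq (s1 := j :: s ++ J))//.
  by rewrite perm_sym perm_catC /= perm_cons perm_catC.
have usJ : uniq (s ++ J) by move: uJ => /andP[].
have ujJ : uniq (j :: J) by move: usjJ; rewrite cat_uniq => /and3P[].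
have uJ' : uniq J by move: ujJ => /andP[].
have us : uniq (s ++ [::]).
  by rewrite cats0; move: usJ; rewrite cat_uniq => /and3P[].
have usj : uniq (s ++ [:: j]).
  rewrite uniq_catC /=; move: uJ => /=.
  by rewrite mem_cat negb_or cats0 in us * => /andP[/andP[-> _] _].
rewrite -[X in _ = prob X * _]setIT -all_occur_nil.
rewrite !prob_few_occur_cons; try exact: measurable_all_occur.
rewrite -!all_occur_cons !IH// !indepG// !big_cons big_nil; ring.
Qed.

Lemma prob_few_occur_rec c j s : uniq (j :: s) ->
  prob (few_occur c.+1 (j :: s)) =
  prob (G j) * prob (few_occur c s) + (1 - prob (G j)) * prob (few_occur c.+1 s).
Proof.
move=> ujs; have ujs' : uniq (s ++ [:: j]) by rewrite uniq_catC.
have := @prob_few_occur_cons c j s setT measurableT; rewrite !setIT => ->.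
have Gj : G j = all_occur [:: j].
  by rewrite all_occur_cons all_occur_nil setIT.
by rewrite {1 2}Gj !few_occur_indep// -Gj; ring.
Qed.

Variable p : R.
Hypothesis p0 : 0 < p.
Hypothesis pG : forall j, p <= prob (G j).

(** The sum is the expected number of events to be inspected in [s] before [c] of
    them have occurred.  One inspection costs 1 and, with probability at least
    [p], lowers by 1 the number of events still required; so [c / p] is a
    supersolution of the recursion. *)
Lemma sum_prob_few_occur c s : uniq s ->
  \sum_(0 <= k < size s) prob (few_occur c (take k s)) <= c%:R / p.
Proof.
elim: s c => [|j s IH] c us.
  by rewrite big_nil divr_ge0// ltW.
case: c => [|c].
  by under eq_bigr do rewrite few_occur0 prob0; rewrite big1// mul0r.
rewrite big_nat_recl//= few_occur_nil probT.
have ujs k : uniq (j :: take k s).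
  have /andP[js us'] := us.
  by rewrite /= take_uniq// andbT; apply: contra js; exact: mem_take.
under eq_bigr do rewrite prob_few_occur_rec//.
rewrite big_split /= -!mulr_sumr.
have /andP[_ /IH IHs] := us.
have q1 : prob (G j) <= 1 by rewrite -probT; exact: prob_le.
apply: (@le_trans _ _ (1 + (prob (G j) * (c%:R / p)
                            + (1 - prob (G j)) * (c.+1%:R / p)))).
  by rewrite lerD2l lerD// ler_wpM2l ?prob_ge0 ?subr_ge0.
have : 1 <= prob (G j) / p by rewrite ler_pdivlMr// mul1r.
by rewrite -[c.+1]addn1 natrD; lra.
Qed.

(** Markov's inequality for the waiting time: the summands of the preceding sum
    decrease in [k]. *)
Lemma prob_few_occur_le c s : uniq s ->
  (size s)%:R * prob (few_occur c s) <= c%:R / p.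
Proof.
move=> us; apply: le_trans (sum_prob_few_occur c us).
rewrite mulr_natl -[X in _ *+ X]subn0 -sumr_const_nat.
apply: ler_sum_nat => k _; apply: prob_le; try exact: measurable_few_occur.
move=> w; rewrite /few_occur /= -[in X in X -> _](cat_take_drop k s) count_cat.
exact/leq_ltn_trans/leq_addr.
Qed.

(** The inspected events are [m-1, m-2, ...]: this is the expectation of
    [waiting_time m]. *)
Lemma expected_waiting_time c m :
  \sum_(0 <= k < m) prob (few_occur c (iota (m - k) k)) <= c%:R / p.
Proof.
have := sum_prob_few_occur c (s := rev (iota 0 m)).
rewrite rev_uniq iota_uniq size_rev size_iota => /(_ isT); apply: le_trans.
rewrite le_eqVlt (eq_big_nat _ _ (F2 := fun k =>
  prob (few_occur c (take k (rev (iota 0 m)))))) ?eqxx// => k /andP[_ km].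
congr (prob _); rewrite take_rev size_iota drop_iota add0n subKn ?(ltnW km)//.
by apply/seteqP; split=> w; rewrite /few_occur /= count_rev.
Qed.

Lemma indic_few_occur c s w :
  \1_(few_occur c s) w = (count (fun j => w \in G j) s < c)%N%:R :> R.
Proof.
rewrite indicE; congr (_%:R); congr nat_of_bool.
by apply/idP/idP => [/set_mem//|]; exact: mem_set.
Qed.

End event_counts.

(** * Bernoulli links *)

Section bernoulli_links.
Context {d : measure_display} {T : measurableType d} {R : realType} {n : nat}.
Variables (Pr : probability T R) (P : nat -> 'M[R]_n).
Variable L : nat -> 'I_n -> 'I_n -> {RV Pr >-> R}.
Hypothesis bernL : forall t i j, bernoulli_rv (L t i j) (P t i j).
Hypothesis indepL :
  mutually_independent (fun k : nat * 'I_n * 'I_n => L k.1.1 k.1.2 k.2).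

Definition all_active (s : seq (nat * 'I_n * 'I_n)) : set T :=
  [set w | all (fun l => L l.1.1 l.1.2 l.2 w == 1) s].

Lemma measurable_all_active s : measurable (all_active s).
Proof.
elim: s => [|l s IH]; first by rewrite (_ : all_active _ = setT)//; exact/seteqP.
rewrite (_ : all_active _ = L l.1.1 l.1.2 l.2 @^-1` [set 1] `&` all_active s).
  by apply: measurableI => //; exact: measurable_funPTI.
apply/seteqP; split=> w /=; first by move=> /andP[/eqP].
by case=> Lw sw; apply/andP; split=> //; exact/eqP.
Qed.

Lemma prob_all_active s : uniq s ->
  prob Pr (all_active s) = \prod_(l <- s) P l.1.1 l.1.2 l.2.
Proof.
move=> us; have := indepL [fset l in s]%fset (fun=> measurable_set1 1).
rewrite (perm_big s); last first.
  by apply: uniq_perm => //; [exact: fset_uniq|move=> l; rewrite !inE].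
rewrite (_ : \bigcap_(k in _) _ = all_active s); last first.
  apply/seteqP; split=> w /= H.
    by apply/allP => l ls; apply/eqP; apply: H; rewrite /= !inE.
  by move=> l /=; rewrite !inE => ls; apply/eqP; exact: (allP H).
rewrite /prob => ->; under eq_bigr do rewrite (bernL _ _ _).1.
by rewrite prodEFin.
Qed.

Lemma bernoulli_ae t i j : {ae Pr, forall w, L t i j w = 0 \/ L t i j w = 1}.
Proof.
have [L1 L0] := bernL t i j.
have m1 : measurable (L t i j @^-1` [set 1]) by exact: measurable_funPTI.
have m0 : measurable (L t i j @^-1` [set 0]) by exact: measurable_funPTI.
pose A := L t i j @^-1` [set 0] `|` L t i j @^-1` [set 1].
exists (~` A); split; first exact/measurableC/measurableU.
- have PrA : Pr A = (1 - P t i j + P t i j)%:E.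
    rewrite /A measureU//; first by rewrite EFinD; congr (_ + _)%E.
    by apply/seteqP; split=> // w [/= -> /esym/eqP]; rewrite oner_eq0.
  rewrite probability_setC; last exact: measurableU.
  by rewrite [X in (_ - X)%E]PrA subrK subee.
- by move=> w /= H [] /= H'; apply: H; [left|right].
Qed.

Lemma certain_link_ae t i j : P t i j = 1 -> {ae Pr, forall w, L t i j w = 1}.
Proof.
move=> P1; have [L1 _] := bernL t i j.
have m1 : measurable (L t i j @^-1` [set 1]) by exact: measurable_funPTI.
exists (~` (L t i j @^-1` [set 1])); split => //; first exact/measurableC.
by rewrite probability_setC// [X in (_ - X)%E]L1 P1 subee.
Qed.

(** An almost sure condition under which every column has a positive sum, so that
    normalizing it yields a column-stochastic matrix. *)
Definition regular_links (w : T) : Prop :=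
  (forall t i j, L t i j w = 0 \/ L t i j w = 1) /\ (forall t i, L t i i w = 1).

Lemma regular_links_ae : (forall t i, P t i i = 1) ->
  {ae Pr, forall w, regular_links w}.
Proof.
move=> P1; apply: filterI.
  apply/ae_foralln => t; apply: filter_forall => i; apply: filter_forall => j.
  exact: bernoulli_ae.
apply/ae_foralln => t; apply: filter_forall => i.
exact: certain_link_ae.
Qed.

Lemma active_weight w t i j : regular_links w -> L t i j w = 1 ->
  n%:R^-1 <= random_weights L w t i j.
Proof.
move=> [L01 L1] Lij; rewrite /random_weights /column_normalize !mxE Lij mul1r.
under eq_bigr do rewrite mxE.
rewrite lef_pV2 ?posrE.
- rewrite -[X in _ <= X%:R]card_ord -sumr_const ler_sum// => k _.
  by case: (L01 t k j) => ->.
- by rewrite ltr0n (leq_ltn_trans (leq0n i)).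
- by rewrite (bigD1 j)//= L1 ltr_pwDl// sumr_ge0// => k _; case: (L01 t k j) => ->.
Qed.

Lemma random_weights_lazy w t : regular_links w -> lazy_weights (random_weights L w t).
Proof.
move=> rw; have [L01 L1] := rw.
have Lge0 i j : 0 <= L t i j w by case: (L01 t i j) => ->.
split; last by move=> i; exact: active_weight.
split=> [i j|j].
  by rewrite !mxE divr_ge0 ?sumr_ge0// => k _; rewrite mxE.
under eq_bigr do rewrite !mxE.
rewrite -mulr_suml; under [X in _ / X]eq_bigr do rewrite mxE.
rewrite divff// gt_eqF//.
by rewrite (bigD1 j)//= L1 ltr_pwDl// sumr_ge0.
Qed.

Variable B : nat.

(** A deterministic certificate for window [k]: if all links of [F] are active,
    then the active links of the window strongly connect the nodes. A link
    [(s, i, j)] is the arc from [j] to [i] at time [s]. *)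
Definition connecting_links (k : nat) (F : seq (nat * 'I_n * 'I_n)) : Prop :=
  [/\ uniq F, (size F <= 2 * (n - 1))%N,
      forall l, l \in F -> (k * B <= l.1.1 < k.+1 * B)%N
                           /\ P l.1.1 l.1.2 l.2 != 0 &
      forall i j, connect (link_rel (fun l => l.2) (fun l => l.1.2) F) i j].

Lemma irreducible_connecting_links k :
  irreducible_mx (\sum_(k * B <= s < k.+1 * B) P s) ->
  exists F, connecting_links k F.
Proof.
move=> irr; pose Q (l : nat * 'I_n * 'I_n) : Prop :=
  (k * B <= l.1.1 < k.+1 * B)%N /\ P l.1.1 l.1.2 l.2 != 0.
have [u v /= uv|F [sF QF cF]] := strongly_connected_links (src := fun l => l.2)
  (tgt := fun l => l.1.2) (Q := Q) _ irr.
  rewrite summxE in uv.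
  have [s ks Ps] : exists2 s, (k * B <= s < k.+1 * B)%N & P s v u != 0.
    apply: contrapT => none; move: uv; rewrite big_nat big1 ?ltxx// => s ks.
    by apply/eqP; apply: contrapT => /negP Ps; apply: none; exists s.
  by exists (s, v, u).
rewrite card_ord -subn1 in sF.
exists (undup F); split.
- exact: undup_uniq.
- by rewrite (leq_trans (size_undup _)).
- by move=> l; rewrite mem_undup => /QF.
- by move=> i j; apply: connect_link_rel_sub (cF i j) => l; rewrite mem_undup.
Qed.

Variable F : nat -> seq (nat * 'I_n * 'I_n).
Hypothesis FP : forall k, connecting_links k (F k).

Lemma uniq_flatten_links J : uniq J -> uniq (flatten (map F J)).
Proof.
elim: J => [//|j J IH] /= /andP[jJ uJ].
have [uF _ FjP _] := FP j.
rewrite cat_uniq uF IH// andbT /=; apply/hasPn => l /flattenP[_ /mapP[k kJ ->] lk].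
have [_ _ FkP _] := FP k.
apply: contra jJ => lj; suff -> : j = k by [].
have [jl _] := FjP _ lj; have [kl _] := FkP _ lk; nia.
Qed.

Lemma all_occur_links J :
  all_occur (fun k => all_active (F k)) J = all_active (flatten (map F J)).
Proof.
elim: J => [|k J IH]; first exact/seteqP.
rewrite all_occur_cons IH /all_active /=.
by apply/seteqP; split=> w /=; rewrite all_cat => /andP.
Qed.

Lemma links_indep J : uniq J ->
  prob Pr (all_occur (fun k => all_active (F k)) J) =
  \prod_(k <- J) prob Pr (all_active (F k)).
Proof.
move=> uJ; rewrite all_occur_links prob_all_active ?uniq_flatten_links//.
rewrite big_flatten big_map /=; apply: eq_bigr => k _.
by rewrite prob_all_active//; have [] := FP k.
Qed.

Lemma prob_links_ge (eps : R) k : 0 < eps -> eps <= 1 ->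
  (forall t i j, P t i j != 0 -> eps <= P t i j) ->
  eps ^+ (2 * (n - 1)) <= prob Pr (all_active (F k)).
Proof.
move=> eps0 eps1 Peps; have [uF sF FkP _] := FP k; rewrite prob_all_active//.
apply: (@le_trans _ _ (eps ^+ size (F k))); first by rewrite ler_wiXn2l// ltW.
have {}FkP l : l \in F k -> eps <= P l.1.1 l.1.2 l.2.
  by move=> /FkP[_ /Peps].
elim: (F k) FkP => [|l s IH] ePs /=; first by rewrite big_nil.
rewrite big_cons exprS; apply: ler_pM; first exact: ltW.
- by rewrite exprn_ge0// ltW.
- by rewrite ePs// mem_head.
by apply: IH => l' l's; rewrite ePs// inE l's orbT.
Qed.

Lemma all_active_connected w k : regular_links w -> w \in all_active (F k) ->
  connected_over (random_weights L w) (k * B) (k.+1 * B).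
Proof.
move=> rw /set_mem/allP Fw; have [_ _ FkP cF] := FP k.
exists (F k); split=> // l lF; have [kl _] := FkP _ lF; split=> //.
by apply: active_weight => //; apply/eqP; exact: Fw.
Qed.

End bernoulli_links.

(** * Measurability and integrals of step functions *)

Section measurability.
Context {d : measure_display} {T : measurableType d} {R : realType}.

(** [x^-1 = x * (x^2)^-1] for all [x], including 0, reduces inversion to a power
    function of a nonnegative argument. *)
Lemma measurable_funV (f : T -> R) : measurable_fun setT f ->
  measurable_fun setT (fun w => (f w)^-1).
Proof.
move=> mf; rewrite (_ : (fun _ => _) = (fun w => f w * (f w ^+ 2) `^ (-1))).
  apply: measurable_funM => //.
  have mf2 : measurable_fun setT (fun w => f w ^+ 2) by exact: measurable_funX.
  exact: (measurableT_comp (measurable_powR (-1)) mf2).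
apply/funext => w; rewrite powR_inv1 ?sqr_ge0//.
have [->|fw0] := eqVneq (f w) 0; first by rewrite invr0 mul0r.
by field.
Qed.

Lemma measurable_fun_lne_abs (f : T -> R) : measurable_fun setT f ->
  measurable_fun setT (fun w => lne `|f w|%:E).
Proof.
move=> mf; have mn : measurable_fun setT (fun w => `|f w|) by exact: measurableT_comp.
rewrite /lne; apply: measurable_fun_ifT => //=.
- exact: measurable_fun_ler.
- by apply/measurable_EFinP; exact: measurableT_comp.
Qed.

Context {n : nat}.
Variables (Pr : probability T R) (L : nat -> 'I_n -> 'I_n -> {RV Pr >-> R}).

Lemma measurable_random_weights t i j :
  measurable_fun setT (fun w => random_weights L w t i j).
Proof.
rewrite (_ : (fun _ => _) = (fun w => L t i j w * (\sum_k L t k j w)^-1)).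
  apply: measurable_funM => //; apply: measurable_funV.
  exact: measurable_sum.
by apply/funext => w; rewrite !mxE; under eq_bigr do rewrite mxE.
Qed.

Lemma measurable_linear_iter v t i :
  measurable_fun setT (fun w => linear_iter (random_weights L w) v t i 0).
Proof.
elim: t i => [|t IH] i; first exact: measurable_cst.
rewrite (_ : (fun _ => _) = (fun w => \sum_j random_weights L w t i j
                              * linear_iter (random_weights L w) v t j 0)).
  apply: measurable_sum => j; apply: measurable_funM => //.
  exact: measurable_random_weights.
by apply/funext => w; rewrite /= mxE.
Qed.

Lemma measurable_log_error x0 t i : measurable_fun setT
  (fun w => lne `|push_sum_ratio (random_weights L w) x0 t i - average x0|%:E).
Proof.
apply: measurable_fun_lne_abs; apply: measurable_funB => //.
apply: measurable_funM; first exact: measurable_linear_iter.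
by apply: measurable_funV; exact: measurable_linear_iter.
Qed.

End measurability.

Section integration.
Context {d : measure_display} {T : measurableType d} {R : realType}.
Variable Pr : probability T R.
Local Open Scope ereal_scope.

(** Positive and negative parts are compared separately, since the logarithm of
    an error may take the value [-oo] and have a non-integrable negative part. *)
Lemma integral_ae_le (f g : T -> \bar R) :
  measurable_fun setT f -> measurable_fun setT g ->
  {ae Pr, forall w, f w <= g w} -> \int[Pr]_w f w <= \int[Pr]_w g w.
Proof.
move=> mf mg fg; rewrite integralE [leRHS]integralE.
apply: leeB; (apply: ae_ge0_le_integral => //;
  [exact: measurable_funepos || exact: measurable_funeneg
  |exact: measurable_funepos || exact: measurable_funeneg|]);
  apply: filterS fg => w fgw _.
- by rewrite !funeposE ge_max le_max fgw le_max lexx orbT.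
- by rewrite !funenegE ge_max le_max leeN2 fgw le_max lexx orbT.
Qed.

Lemma integral_step (I : Type) (s : seq I) (a : I -> R) (E : I -> set T) (c : R) :
  (forall i, measurable (E i)) ->
  \int[Pr]_w (c + \sum_(i <- s) a i * \1_(E i) w)%R%:E =
  (c + \sum_(i <- s) a i * prob Pr (E i))%R%:E.
Proof.
move=> mE.
have iE i : Pr.-integrable setT (fun w => (a i)%:E * (\1_(E i) w)%:E).
  by apply: integrableZl => //; exact: integrable_indic.
have ic : Pr.-integrable setT (EFin \o cst c).
  exact: finite_measure_integrable_cst.
pose g w := (\sum_(i <- s) a i * \1_(E i) w)%R.
have gE : EFin \o g = (fun w => \sum_(i <- s) (a i)%:E * (\1_(E i) w)%:E).
  apply/funext => w; rewrite /g /= -sumEFin.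
  by apply: eq_bigr => i _; rewrite EFinM.
have ig : Pr.-integrable setT (EFin \o g) by rewrite gE; exact: integrable_sum.
transitivity (\int[Pr]_w (EFin \o cst c \+ (EFin \o g)) w).
  by apply: eq_integral => w _; rewrite /= EFinD.
rewrite integralD_EFin// EFinD gE; congr (_ + _).
  have := integral_cst Pr measurableT c%:E.
  by rewrite [X in c%:E * X](probability_setT Pr) mule1.
rewrite integral_sum// -sumEFin; apply: eq_bigr => i _.
rewrite integralZl//; last exact: integrable_indic.
by rewrite integral_indic// setIT EFinM; congr (_ * _); exact: probE.
Qed.

Lemma measurable_step (I : Type) (s : seq I) (a : I -> R) (E : I -> set T) (c : R) :
  (forall i, measurable (E i)) ->
  measurable_fun setT (fun w => (c + \sum_(i <- s) a i * \1_(E i) w)%R%:E).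
Proof.
move=> mE; apply/measurable_EFinP; apply: measurable_funD => //.
by apply: measurable_sum => i; apply: measurable_funM.
Qed.

End integration.

(** * The numerical rate *)

(** [s] is the ideal number of blocks and [K] the number of complete ones, each
    good with probability at least 1/2.  Since [(1 - a) <= (1 - a^2)^2], half of
    [ln (1 - a)] is a full [ln (1 - a^2)], and the two lost blocks are paid by
    [ln 15]. *)
Lemma half_block_rate (R : realType) (a s K : R) :
  0 < a -> a <= 2^-1 -> 0 <= s -> s - 2 <= K ->
  K / 2 * ln (1 - a) <= ln 15 + s * ln (1 - a ^+ 2).
Proof.
move=> a0 a2 s0 sK.
have sq_lt1 : 0 < 1 - a ^+ 2 by nra.
have rate : ln (1 - a) <= 2 * ln (1 - a ^+ 2).
  rewrite mulr_natl -lnXn// ler_ln ?posrE ?exprn_gt0//; last lra.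
  by rewrite [leRHS]expr2; nra.
have ln15 : - ln 15 <= ln (1 - a).
  rewrite -lnV ?posrE// ler_ln ?posrE ?invr_gt0//; last lra.
  by rewrite (@le_trans _ _ 2^-1)//; [rewrite lef_pV2 ?posrE// ler_nat|lra].
have ln_le0 : ln (1 - a) <= 0 by rewrite ln_le0//; lra.
by nra.
Qed.

Lemma block_rate (R : realType) (n B t q : nat) (p : R) :
  (2 <= n)%N -> (0 < B)%N -> 0 < p -> p <= 1 ->
  2 * n.-1%:R / p <= q%:R -> q%:R <= 2 * n.-1%:R / p + 1 -> (0 < q)%N ->
  (t.+1 %/ B %/ q)%:R / 2 * ln (1 - n%:R^-1 ^+ (q * B)) <=
  ln 15 + p / (2 * n%:R * B%:R)
          * ln (1 - 1 / n%:R `^ (4 * n%:R * B%:R / p)) * t%:R :> R.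
Proof.
move=> n2 B0 p0 p1 qlow qup q0.
set M : R := 2 * n%:R * B%:R / p; set K := (t.+1 %/ B %/ q)%N.
have n2R : 2 <= n%:R :> R by rewrite ler_nat.
have B1R : 1 <= B%:R :> R by rewrite ler1n.
have q1R : 1 <= q%:R :> R by rewrite ler1n.
have pV1 : 1 <= p^-1 by rewrite invf_ge1.
have nE : n.-1%:R = n%:R - 1 :> R by rewrite -subn1 natrB// (ltnW n2).
have pV : p * p^-1 = 1 by rewrite divff// gt_eqF.
(* Rounding up q costs B, less than the 2B/p gained from n - 1 versus n. *)
have qBM : (q * B)%:R <= M.
  rewrite natrM /M mulrAC ler_wpM2r//.
  by rewrite (le_trans qup)// nE; lra.
have M1 : 1 <= M.
  by apply: le_trans qBM; rewrite natrM mulr_ege1.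
pose a : R := n%:R `^ (- M).
have n0R : 0 < n%:R :> R by rewrite ltr0n (leq_trans _ n2).
have n1R : 1 <= n%:R :> R by rewrite ler1n (leq_trans _ n2).
have a0 : 0 < a by exact: powR_gt0.
have a_le : a <= n%:R^-1 ^+ (q * B).
  rewrite /a powRN exprVn lef_pV2 ?posrE ?exprn_gt0 ?powR_gt0//.
  by rewrite -powR_mulrn ?(ltW n0R)// ler_powR.
have a2 : a <= 2^-1.
  rewrite /a powRN lef_pV2 ?posrE ?powR_gt0//.
  by rewrite (le_trans n2R)// -[leLHS]powRr1 ?(ltW n0R)// ler_powR.
have aa : 1 / n%:R `^ (4 * n%:R * B%:R / p) = a ^+ 2.
  rewrite /a powRN exprVn div1r -powR_mulrn ?powR_ge0// -powRrM.
  by congr (_ `^ _)^-1; rewrite /M; field; rewrite gt_eqF.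
have al1 : n%:R^-1 ^+ (q * B) < 1 :> R.
  rewrite exprn_ilt1 ?invr_ge0 ?ler0n//.
    by rewrite -lt0n muln_gt0 q0.
  by rewrite invf_lt1// ltr1n.
have B0R : 0 < B%:R :> R by rewrite ltr0n.
pose s : R := p / (2 * n%:R * B%:R) * t%:R.
have sM : s * M = t%:R.
  by rewrite /s /M; field; rewrite !gt_eqF.
have s0 : 0 <= s.
  by rewrite /s mulr_ge0// divr_ge0// ?ltW// !mulr_gt0.
(* Rounding t to windows and windows to blocks each loses at most one block. *)
have sK : s - 2 <= K%:R.
  have tB : (t.+1 <= (t.+1 %/ B).+1 * B)%N by rewrite ltnW// ltn_ceil.
  have mq : ((t.+1 %/ B).+1 <= K.+1 * q)%N by rewrite ltn_ceil.
  have tKM : t%:R - B%:R <= K.+1%:R * M :> R.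
    apply: (@le_trans _ _ (K.+1%:R * (q * B)%:R)).
      rewrite -natrM lerBlDr -natrD ler_nat.
      rewrite mulnA (leq_trans _ (leq_addr _ _))// ltnW//.
      by rewrite (leq_trans tB)// leq_mul2r mq orbT.
    by rewrite ler_wpM2l.
  have BM : B%:R <= M.
    by rewrite (le_trans _ qBM)// ler_nat leq_pmull.
  have : (s - 2) * M <= K%:R * M.
    by rewrite mulrBl sM; move: tKM; rewrite -natr1 mulrDl mul1r; lra.
  by rewrite ler_pM2r// (lt_le_trans _ M1).
apply: (@le_trans _ _ (K%:R / 2 * ln (1 - a))).
  rewrite ler_wpM2l ?divr_ge0// ler_ln ?posrE ?subr_gt0//.
    by rewrite lerD2l lerN2.
  exact: le_lt_trans al1.
rewrite aa [p / _ * _ * _]mulrAC -/s; exact: half_block_rate.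
Qed.

(** * The expected logarithmic error *)

Lemma ln_prod (R : realType) (I : Type) (s : seq I) (F : I -> R) :
  (forall i, 0 < F i) -> ln (\prod_(i <- s) F i) = \sum_(i <- s) ln (F i).
Proof.
move=> F0; elim: s => [|i s IH]; first by rewrite !big_nil ln1.
by rewrite !big_cons lnM ?posrE ?prodr_gt0// IH.
Qed.

Section log_error.
Context {d : measure_display} {T : measurableType d} {R : realType} {n : nat}.
Variables (Pr : probability T R) (L : nat -> 'I_n -> 'I_n -> {RV Pr >-> R}).
Variables (B : nat) (G : nat -> set T) (x0 : 'cV[R]_n).
Hypothesis n2 : (2 <= n)%N.
Hypothesis B0 : (0 < B)%N.
Hypothesis G_connected : forall w k, regular_links L w -> w \in G k ->
  connected_over (random_weights L w) (k * B) (k.+1 * B).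
Hypothesis x0_gt0 : 0 < norm1 x0.

Let beta (q : nat) : R := ln (1 - n%:R^-1 ^+ (q * B)).

(** The logarithm of [push_sum_error_bound] as a constant plus a nonnegative
    combination of indicators: a block contributes [beta] unless it has too few
    good windows, whence the constant [K * beta] and the coefficients
    [- beta]. *)
Lemma log_error_le w m r q K i : regular_links L w ->
  (0 < q)%N -> (K * q <= m)%N ->
  (lne `|push_sum_ratio (random_weights L w) x0 (m * B + r) i - average x0|%:E
   <= (ln (2 * norm1 x0) + ln n%:R * r%:R + K%:R * beta q
       + (\sum_(0 <= k < m) ln n%:R * B%:R
            * \1_(few_occur G n.-1 (iota (m - k) k)) w
          + \sum_(0 <= b < K) (- beta q)
            * \1_(few_occur G n.-1 (iota (b * q) q)) w))%:E)%E.
Proof.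
move=> rw q0 Kqm.
have n0 : (0 < n)%N by exact: leq_trans n2.
have n0R : 0 < n%:R :> R by rewrite ltr0n.
have lazy t : lazy_weights (random_weights L w t) by exact: random_weights_lazy.
have good_conn k : w \in G k -> connected_over (random_weights L w) (k * B) (k.+1 * B).
  exact: G_connected.
have := push_sum_error_bound lazy (good := fun k => w \in G k) good_conn x0 r i n0 Kqm.
set bf := block_factor B _ q; set N := waiting_time _ m => err.
have al1 : n%:R^-1 ^+ (q * B) < 1 :> R.
  rewrite exprn_ilt1 ?invr_ge0 ?ler0n//.
    by rewrite -lt0n muln_gt0 q0.
  by rewrite invf_lt1// ltr1n.
have bf0 b : 0 < bf b.
  by rewrite /bf /block_factor; case: ifP => // _; rewrite subr_gt0.
have prod0 : 0 < \prod_(b < K) bf b by exact: prodr_gt0.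
have pow0 e : 0 < n%:R ^+ e :> R by rewrite exprn_gt0.
have bnd0 : 0 < 2 * norm1 x0 * \prod_(b < K) bf b * n%:R ^+ (r + B * N).
  by rewrite !mulr_gt0.
have lnbf b : ln (bf b) = beta q - beta q * \1_(few_occur G n.-1 (iota (b * q) q)) w.
  rewrite indic_few_occur /bf /block_factor leqNgt.
  by case: ltnP => _ /=; rewrite ?mulr1 ?mulr0 ?subr0 ?subrr ?ln1.
apply: (@le_trans _ _ (lne (2 * norm1 x0 * \prod_(b < K) bf b
                            * n%:R ^+ (r + B * N))%:E)).
  by rewrite lee_lne ?in_itv/= ?leey ?andbT ?lee_fin ?(ltW bnd0).
rewrite lne_EFin// lee_fin !lnM ?posrE ?mulr_gt0// lnXn// ln_prod//.
have -> : \sum_(b < K) ln (bf b) = K%:R * beta q +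
    \sum_(0 <= b < K) - beta q * \1_(few_occur G n.-1 (iota (b * q) q)) w.
  rewrite big_mkord; under eq_bigr do rewrite lnbf.
  rewrite sumrB sumr_const card_ord mulr_natl -sumrN; congr (_ + _).
  by apply: eq_bigr => b _; rewrite mulNr.
have -> : ln n%:R *+ (r + B * N) = ln n%:R * r%:R +
    \sum_(0 <= k < m) ln n%:R * B%:R
      * \1_(few_occur G n.-1 (iota (m - k) k)) w :> R.
  under eq_bigr do rewrite indic_few_occur.
  rewrite -mulr_sumr.
  by rewrite -natr_sum -/(waiting_time _ m) -/N -[LHS]mulr_natr natrD natrM mulrDr mulrA.
lra.
Qed.

Variable p : R.
Hypothesis mG : forall j, measurable (G j).
Hypothesis indepG : forall J : seq nat, uniq J ->
  prob Pr (all_occur G J) = \prod_(j <- J) prob Pr (G j).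
Hypothesis p0 : 0 < p.
Hypothesis pG : forall j, p <= prob Pr (G j).
Hypothesis regular_ae : {ae Pr, forall w, regular_links L w}.

(** A block is at least twice as long as the bound [n.-1 / p] on the expected
    waiting time for [n.-1] good windows, so it fails with probability at most
    1/2. *)
Lemma expected_log_error_le m r q K i : (0 < q)%N -> (K * q <= m)%N ->
  2 * n.-1%:R / p <= q%:R ->
  (\int[Pr]_w lne `|push_sum_ratio (random_weights L w) x0 (m * B + r) i
                    - average x0|%:E
   <= (ln (2 * norm1 x0) + ln n%:R * (r%:R + B%:R * (n.-1%:R / p))
       + K%:R / 2 * beta q)%:E)%E.
Proof.
move=> q0 Kqm qp.
have n0R : 1 <= n%:R :> R by rewrite ler1n (leq_trans _ n2).
(* Left summands index the windows before m * B, right ones the blocks. *)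
pose E (k : nat + nat) : set T := match k with
  | inl k => few_occur G n.-1 (iota (m - k) k)
  | inr b => few_occur G n.-1 (iota (b * q) q) end.
pose a (k : nat + nat) : R :=
  match k with inl _ => ln n%:R * B%:R | inr _ => - beta q end.
pose s : seq (nat + nat) := map inl (index_iota 0 m) ++ map inr (index_iota 0 K).
pose c : R := ln (2 * norm1 x0) + ln n%:R * r%:R + K%:R * beta q.
have mE k : measurable (E k) by case: k => k; exact: measurable_few_occur.
apply: (@le_trans _ _ (\int[Pr]_w (c + \sum_(k <- s) a k * \1_(E k) w)%:E)%E).
  apply: integral_ae_le; [exact: measurable_log_error|exact: measurable_step|].
  apply: filterS regular_ae => w rw; rewrite big_cat !big_map /=.
  exact: log_error_le.
rewrite integral_step// lee_fin /s big_cat !big_map /= -!mulr_sumr.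
have al1 : 0 <= - beta q.
  rewrite oppr_ge0 /beta ln_le0// lerBlDr lerDl exprn_ge0// invr_ge0; lra.
have wait : \sum_(0 <= k < m) prob Pr (few_occur G n.-1 (iota (m - k) k)) <= n.-1%:R / p.
  exact: expected_waiting_time.
have fail : \sum_(0 <= b < K) prob Pr (few_occur G n.-1 (iota (b * q) q)) <= K%:R / 2.
  have -> : K%:R / 2 = \sum_(0 <= b < K) 2^-1 :> R.
    by rewrite sumr_const_nat subn0 mulr_natl.
  apply: ler_sum => b _.
  have q0R : 0 < q%:R :> R by rewrite ltr0n.
  rewrite -(ler_pM2l q0R); apply: (@le_trans _ _ (n.-1%:R / p)); last lra.
  have := prob_few_occur_le mG indepG p0 pG n.-1 (iota_uniq (b * q) q).
  by rewrite size_iota.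
have := ler_wpM2l al1 fail.
have lnB : 0 <= ln n%:R * B%:R :> R by rewrite mulr_ge0// ln_ge0.
have := ler_wpM2l lnB wait.
rewrite /c; lra.
Qed.

End log_error.

Theorem theorem2 (R : realType) (d : measure_display) (T : measurableType d)
    (Pr : probability T R) (n : nat) (P : nat -> 'M[R]_n) (eps : R) (B : nat)
    (L : nat -> 'I_n -> 'I_n -> {RV Pr >-> R}) (x0 : 'cV[R]_n) :
  (2 <= n)%N ->
  (forall t i j, 0 <= P t i j <= 1) ->
  (forall t i, P t i i = 1) ->
  0 < eps ->
  (forall t i j, P t i j != 0 -> eps <= P t i j) ->
  (0 < B)%N ->
  B_irreducible B P ->
  (forall t i j, bernoulli_rv (L t i j) (P t i j)) ->
  mutually_independent (fun k : nat * 'I_n * 'I_n => L k.1.1 k.1.2 k.2) ->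
  let p : R := eps ^+ (2 * (n - 1)) in
  let c0 : \bar R :=
    (lne (2 * norm1 x0)%:E
     + (ln n%:R * (n%:R * B%:R / p + B%:R))%:E + (ln 15)%:E)%E in
  let c1 : R :=
    - (p / (2 * n%:R * B%:R)) * ln (1 - 1 / n%:R `^ (4 * n%:R * B%:R / p)) in
  forall (t : nat) (i : 'I_n),
    B%:R + 2 * n%:R * B%:R / p <= t%:R ->
    (\int[Pr]_w lne `|push_sum_ratio (random_weights L w) x0 t.+1 i
                       - average x0|%R%:E
     <= c0 - (c1 * t%:R)%:E)%E.
Proof.
move=> n2 P01 P1 eps0 Peps B0 irr bernL indepL p c0 c1 t i _.
have [x00|x0N] := eqVneq (norm1 x0) 0.
  rewrite (_ : (fun w => _) = cst -oo%E).
    rewrite (integral_cst Pr measurableT) [X in (_ * X)%E](probability_setT Pr).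
    by rewrite mule1 leNye.
  apply/funext => w; rewrite (norm1_eq0 x00) /push_sum_ratio.
  have -> : linear_iter (random_weights L w) 0 t.+1 = 0.
    by have := linear_iterB (random_weights L w) 0 0 t.+1; rewrite !subrr.
  rewrite mxE mul0r sub0r normrN /average big1 ?mulr0 ?normr0 => [|j _].
    by rewrite le0_lneNy.
  by rewrite mxE.
have x0_gt0 : 0 < norm1 x0 by rewrite lt_neqAle eq_sym x0N norm1_ge0.
have eps1 : eps <= 1.
  by rewrite -(P1 0%N i) Peps// P1 oner_eq0.
have p0 : 0 < p by rewrite exprn_gt0.
have p1 : p <= 1 by rewrite exprn_ile1// ltW.
(* The links of each window are chosen from P alone, before any randomness. *)
have [F FP] := choice (fun k => irreducible_connecting_links (irr k)).
pose G k := all_active L (F k).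
have mG k : measurable (G k) by exact: measurable_all_active.
have indepG J : uniq J -> prob Pr (all_occur G J) = \prod_(j <- J) prob Pr (G j).
  exact: (links_indep bernL indepL FP).
have pG k : p <= prob Pr (G k) by exact: (prob_links_ge bernL indepL FP).
have G_connected w k : regular_links L w -> w \in G k ->
    connected_over (random_weights L w) (k * B) (k.+1 * B).
  exact: (all_active_connected FP).
have x_ge0 : 0 <= 2 * n.-1%:R / p by rewrite divr_ge0 ?mulr_ge0// ltW.
pose q := (Num.truncn (2 * n.-1%:R / p)).+1.
have /andP[q_le q_gt] := truncn_itv x_ge0.
have qlow : 2 * n.-1%:R / p <= q%:R by exact: ltW.
have qup : q%:R <= 2 * n.-1%:R / p + 1 by rewrite /q -natr1 lerD2r.
have q0 : (0 < q)%N by [].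
have regular_ae := regular_links_ae bernL P1.
rewrite (divn_eq t.+1 B).
apply: le_trans (expected_log_error_le n2 B0 G_connected x0_gt0 mG indepG p0 pG
  regular_ae _ _ q0 (leq_divM _ q) qlow) _.
have rate := block_rate t n2 B0 p0 p1 qlow qup q0.
rewrite /c0 /c1 lne_EFin ?mulr_gt0// -!EFinD lee_fin.
have rB : (t.+1 %% B)%:R <= B%:R :> R by rewrite ler_nat ltnW// ltn_mod.
have nn : B%:R * (n.-1%:R / p) <= n%:R * B%:R / p.
  rewrite mulrA [B%:R * _]mulrC ler_wpM2r ?invr_ge0 ?(ltW p0)//.
  by rewrite ler_wpM2r// ler_nat leq_pred.
have lnn : 0 <= ln n%:R :> R by rewrite ln_ge0// ler1n (leq_trans _ n2).
have := ler_wpM2l lnn (lerD rB nn).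
lra.
Qed.
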